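(* Let $p$ be a prime and let $P$ be a no-signalling box with inputs and outputs in $\mathbb{Z}_p$ that satisfies information causality. Then for every integer $N$ with $1\le N\le p$ and every $c\in\mathbb{Z}_p$, $$\frac1p\sum_{k=0}^{p-1}\omega_p^{ck}\Big(\sum_{j=0}^{p-1}\mu_j\omega_p^{jk}\Big)^{N-1}\le T_p^{-1}\Big(\frac{N-1}{N}\log_2p\Big),$$ where $\omega_p=e^{2\pi i/p}$ and $\mu_j=\frac1{p^2}\sum_{x,y=0}^{p-1}\sum_{k=0}^{p-1}P(a=k,\,b=k-xy+j\mid x,y)$.
   Context: Let $p$ be a prime. All arithmetic on elements of $\mathbb{Z}_p$ is modulo $p$. A box is a conditional probability distribution $P(a,b\mid x,y)$ with $a,b,x,y\in\mathbb{Z}_p$. It is shared by Alice, who supplies $x$ and receives $a$, and Bob, who supplies $y$ and receives $b$. Different copies act independently. $P$ is no-signalling if $\sum_bP(a,b\mid x,y)$ does not depend on $y$ and $\sum_aP(a,b\mid x,y)$ does not depend on $x$. $P$ satisfies information causality if, for every $N\ge1$, every protocol of the following form satisfies $\sum_{i=0}^{N-1}I(x_i:b\mid y=i)\le\log_2p$. In the protocol: - Alice receives $\vec x=(x_0,\dots,x_{N-1})$ uniform in $\mathbb{Z}_p^N$, and Bob receives $y$ uniform in $\{0,\dots,N-1\}$, independent of $\vec x$. - They share randomness (independent of the inputs) and finitely many copies of $P$. - Alice's inputs to her ends of the boxes are functions of $\vec x$, the shared randomness, and her previously obtained outputs. - Alice sends a single message $q\in\mathbb{Z}_p$ to Bob,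 which is a function of $\vec x$, the randomness, and her outputs. - Bob's inputs to his ends of the boxes are functions of $y$, $q$, the shared randomness, and his previously obtained outputs. - Bob finally outputs $b\in\mathbb{Z}_p$. Here $I(x_i:b\mid y=i)$ is the Shannon mutual information (in bits) between $x_i$ and $b$ under the distribution conditioned on $y=i$. Let $h(x)=-x\log_2x-(1-x)\log_2(1-x)$ and $T_p(x)=h(x)+(1-x)\log_2(p-1)$. On $[1/p,1]$, $T_p$ decreases strictly from $\log_2p$ to $0$. $T_p^{-1}:[0,\log_2p]\to[1/p,1]$ denotes the inverse of this restriction. *)

(* Defs.v *)
From Stdlib Require Import Reals ClassicalEpsilon.
From mathcomp Require Import all_boot.

Set Implicit Arguments.
Unset Strict Implicit.
Unset Printing Implicit Defensive.

Local Open Scope R_scope.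

Definition rsum (I : finType) (F : I -> R) : R := \big[Rplus/0]_(i : I) F i.
Definition rprod (I : finType) (F : I -> R) : R := \big[Rmult/1]_(i : I) F i.

Definition log2 (x : R) : R := ln x / ln 2.

(* A box on Z_p (Z_p represented by the ordinal type 'I_p):
   P a b x y = P(a,b | x,y). *)
Definition box (p : nat) := 'I_p -> 'I_p -> 'I_p -> 'I_p -> R.

Definition is_box (p : nat) (P : box p) : Prop :=
  (forall a b x y, 0 <= P a b x y) /\
  (forall x y, rsum (fun a => rsum (fun b => P a b x y)) = 1).

Definition no_signalling (p : nat) (P : box p) : Prop :=
  (forall a x y y', rsum (fun b => P a b x y) = rsum (fun b => P a b x y')) /\
  (forall b x x' y, rsum (fun a => P a b x y) = rsum (fun a => P a b x' y)).

(* N = number of Alice's dits, p = alphabet size.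
   nr = size of the (finite) shared-randomness space, pi its distribution.
   m  = number of copies of the box; they are used in the order 0,...,m-1.
   fA t xv r s : Alice's input to box t, given her data xv, the randomness r
                 and the list s of her previous outputs (outputs of boxes < t).
   qA xv r a   : Alice's message (a = all her outputs).
   gB t y q r s: Bob's input to box t, given y, the message q, randomness r
                 and his previous outputs s.
   bB y q r b  : Bob's final guess (b = all his outputs). *)
Record protocol (N p : nat) := Protocol {
  nr : nat;
  pi : 'I_nr -> R;
  m  : nat;
  fA : nat -> {ffun 'I_N -> 'I_p} -> 'I_nr -> seq 'I_p -> 'I_p;
  qA : {ffun 'I_N -> 'I_p} -> 'I_nr -> m.-tuple 'I_p -> 'I_p;
  gB : nat -> 'I_N -> 'I_p -> 'I_nr -> seq 'I_p -> 'I_p;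
  bB : 'I_N -> 'I_p -> 'I_nr -> m.-tuple 'I_p -> 'I_p
}.
Arguments nr {N p} _.
Arguments pi {N p} _ _.
Arguments m {N p} _.
Arguments fA {N p} _ _ _ _ _.
Arguments qA {N p} _ _ _ _.
Arguments gB {N p} _ _ _ _ _ _.
Arguments bB {N p} _ _ _ _ _.

Definition valid_protocol N p (pr : protocol N p) : Prop :=
  (forall r, 0 <= pi pr r) /\ rsum (pi pr) = 1.

Definition joint N p (P : box p) (pr : protocol N p)
  (xv : {ffun 'I_N -> 'I_p}) (y : 'I_N) (r : 'I_(nr pr))
  (a b : (m pr).-tuple 'I_p) : R :=
  rprod (fun t : 'I_(m pr) =>
    P (tnth a t) (tnth b t)
      (fA pr t xv r (take t a))
      (gB pr t y (qA pr xv r a) r (take t b))).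

Arguments joint {N p} P pr xv y r a b.

(* joint distribution of (x_i, Bob's output) conditioned on y = i,
   with xv uniform on Z_p^N *)
Definition dist_xb N p (P : box p) (pr : protocol N p) (i : 'I_N)
  (u v : 'I_p) : R :=
  rsum (fun xv : {ffun 'I_N -> 'I_p} =>
    if xv i == u then
      / (INR p ^ N) *
      rsum (fun r : 'I_(nr pr) => pi pr r *
        rsum (fun a : (m pr).-tuple 'I_p =>
          rsum (fun b : (m pr).-tuple 'I_p =>
            if bB pr i (qA pr xv r a) r b == v then joint P pr xv i r a b
            else 0)))
    else 0).

(* Shannon mutual information (bits) of a joint distribution J on Z_p x Z_p,
   with the convention 0 log 0 = 0 *)
Definition mutinf p (J : 'I_p -> 'I_p -> R) : R :=
  rsum (fun u => rsum (fun v =>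
    if Rlt_dec 0 (J u v) then
      J u v * log2 (J u v / (rsum (fun v' => J u v') * rsum (fun u' => J u' v)))
    else 0)).

Definition info_causality (p : nat) (P : box p) : Prop :=
  forall (N : nat) (pr : protocol N p), (1 <= N)%N -> valid_protocol pr ->
    rsum (fun i : 'I_N => mutinf (dist_xb P pr i)) <= log2 (INR p).

Definition xlog2x (x : R) : R := if Rlt_dec 0 x then x * log2 x else 0.
Definition hbin (x : R) : R := - xlog2x x - xlog2x (1 - x).
Definition Tp (p : nat) (x : R) : R := hbin x + (1 - x) * log2 (INR p - 1).

(* T_p^{-1}(z): the (unique) y in [1/p, 1] with T_p(y) = z *)
Definition Tp_inv (p : nat) (z : R) : R :=
  epsilon (inhabits 0) (fun y => / INR p <= y <= 1 /\ Tp p y = z).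

Definition Cx := (R * R)%type.
Definition Cadd (z w : Cx) : Cx := (fst z + fst w, snd z + snd w).
Definition Cmul (z w : Cx) : Cx :=
  (fst z * fst w - snd z * snd w, fst z * snd w + snd z * fst w).
Definition Cscale (a : R) (z : Cx) : Cx := (a * fst z, a * snd z).
Fixpoint Cpow (z : Cx) (n : nat) : Cx :=
  match n with O => (1, 0) | S n' => Cmul z (Cpow z n') end.
Definition Csum (I : finType) (F : I -> Cx) : Cx :=
  \big[Cadd/(0,0)]_(i : I) F i.

Definition omega_pow (p e : nat) : Cx :=
  (cos (2 * PI * INR e / INR p), sin (2 * PI * INR e / INR p)).

Definition zmodp (p : nat) (Hp : (0 < p)%N) (n : nat) : 'I_p :=
  Ordinal (ltn_pmod n Hp).

Definition mu (p : nat) (Hp : (0 < p)%N) (P : box p) (j : 'I_p) : R :=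
  / (INR p ^ 2) *
  rsum (fun x : 'I_p => rsum (fun y : 'I_p => rsum (fun k : 'I_p =>
    P k (zmodp Hp (k + (p - (x * y) %% p) + j)) x y))).

Definition lhs (p : nat) (Hp : (0 < p)%N) (P : box p) (n : nat) (c : 'I_p) : Cx :=
  Cscale (/ INR p)
    (Csum (fun k : 'I_p =>
       Cmul (omega_pow p (c * k))
            (Cpow (Csum (fun j : 'I_p =>
                     Cscale (mu Hp P j) (omega_pow p (j * k)))) n.-1))).

(* Main.v *)
(** Alice and Bob run a random access code with [n - 1] boxes, based on
    [x_y = x_0 + sum_t (x_t - x_0) [y = t]]: box [t] is fed [x_t - x_0] and
    [[y = t]], and a box producing [b = a - xy + e] yields the product of its
    inputs up to the error [e].  Masking both inputs with shared uniform
    randomness, which the two parties can compensate locally, makes the errors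
    independent with law [mu] whatever the data.  Bob's guess is therefore
    [x_y - E] with [E] a sum of [n - 1] independent errors, so information
    causality reads [n (log2 p - H(E)) <= log2 p].  By Fourier inversion the
    left-hand side of the theorem is [Prob(E = - c)], and Fano's inequality
    [H(E) <= Tp (Prob(E = - c))] together with the monotonicity of [Tp] gives
    the bound. *)

From HB Require Import structures.
From Stdlib Require Import Reals Lra ClassicalEpsilon.
From Coquelicot Require Import Coquelicot.
From mathcomp Require Import all_boot all_algebra.
Require Import Defs.

Set Implicit Arguments.
Unset Strict Implicit.
Unset Printing Implicit Defensive.

Local Open Scope R_scope.

(** * The function [Tp] and its inverse *)

Lemma ln2_gt0 : 0 < ln 2.
Proof. rewrite -ln_1; apply: ln_increasing; lra. Qed.

Lemma ln_lt_sub1 (u : R) : 0 < u -> u <> 1 -> ln u < u - 1.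
Proof.
move=> u0 u1; have H : ln u <> 0 by move=> h; apply: u1; rewrite -(exp_ln u) // h exp_0.
by have := exp_ineq1 _ H; rewrite exp_ln //; lra.
Qed.

Lemma log2M (x y : R) : 0 < x -> 0 < y -> log2 (x * y) = log2 x + log2 y.
Proof. by move=> x0 y0; rewrite /log2 ln_mult //; lra. Qed.

Lemma log2V (x : R) : 0 < x -> log2 (/ x) = - log2 x.
Proof. by move=> x0; rewrite /log2 ln_Rinv //; lra. Qed.

Lemma log2_le (x y : R) : 0 < x -> x <= y -> log2 x <= log2 y.
Proof.
move=> x0 xy; apply: Rmult_le_compat_r; first by have := Rinv_0_lt_compat _ ln2_gt0; lra.
exact: ln_le.
Qed.

Lemma log2_gt0 (x : R) : 1 < x -> 0 < log2 x.
Proof.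
move=> x1; apply: Rdiv_lt_0_compat ln2_gt0.
by rewrite -ln_1; apply: ln_increasing; lra.
Qed.

Lemma xlog2xE (x : R) : 0 < x -> xlog2x x = x * log2 x.
Proof. by rewrite /xlog2x; case: Rlt_dec. Qed.

Lemma xlog2x0 : xlog2x 0 = 0.
Proof. by rewrite /xlog2x; case: Rlt_dec => // h; lra. Qed.

(** Strict convexity of [x log2 x]: the left-hand side is its tangent line at [t]. The endpoint
    [x = 0] is included, so the bound also covers outcomes of probability zero. *)
Lemma gibbs_lt (x t : R) : 0 <= x -> 0 < t -> x <> t ->
  x * log2 t + (x - t) / ln 2 < xlog2x x.
Proof.
move=> x0 t0 xt; have l2 := ln2_gt0.
case: (Rle_lt_or_eq_dec _ _ x0) => [xp|<-]; last first.
  rewrite xlog2x0; have := Rdiv_lt_0_compat _ _ t0 l2; lra.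
rewrite xlog2xE // /log2.
have h : t / x <> 1.
  move=> e; apply: xt; have : t = t / x * x by field; lra.
  by rewrite e; lra.
have tx : 0 < t / x by exact: Rdiv_lt_0_compat.
have := ln_lt_sub1 tx h; rewrite ln_div // => H.
have {}H : x * (ln t - ln x) < t - x.
  have -> : t - x = x * (t / x - 1) by field; lra.
  exact: Rmult_lt_compat_l.
apply: (Rmult_lt_reg_r (ln 2)) => //.
have -> : (x * (ln t / ln 2) + (x - t) / ln 2) * ln 2 = x * ln t + (x - t) by field; lra.
have -> : x * (ln x / ln 2) * ln 2 = x * ln x by field; lra.
lra.
Qed.

Lemma gibbs_le (x t : R) : 0 <= x -> 0 < t ->
  x * log2 t + (x - t) / ln 2 <= xlog2x x.
Proof.
move=> x0 t0; case: (Req_dec x t) => [->|xt]; last exact/Rlt_le/gibbs_lt.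
by rewrite xlog2xE //; lra.
Qed.

(* By Gibbs' inequality, [Tp] lies below its tangent at [y], whose slope
   [log2 ((1 - y) / ((p - 1) y))] is nonpositive as soon as [1 / p <= y]. *)
Lemma Tp_decr (p : nat) (x y : R) :
  2 <= INR p -> / INR p <= y -> y < x -> x <= 1 -> Tp p x < Tp p y.
Proof.
move=> p2 py yx x1; rewrite /Tp /hbin.
have p0 : 0 < / INR p by apply: Rinv_0_lt_compat; lra.
have := gibbs_lt (x := x) (t := y); have := gibbs_lt (x := 1 - x) (t := 1 - y).
move=> /(_ ltac:(lra) ltac:(lra) ltac:(lra)) h1 /(_ ltac:(lra) ltac:(lra) ltac:(lra)) h2.
rewrite (xlog2xE (x := y)); last lra.
rewrite (xlog2xE (x := 1 - y)); last lra.
have h3 : log2 (1 - y) <= log2 y + log2 (INR p - 1).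
  rewrite -log2M; [|lra|lra]; apply: log2_le; first lra.
  have : / INR p * INR p <= y * INR p by apply: Rmult_le_compat_r; lra.
  by rewrite Rinv_l; lra.
have h4 : 0 <= (x - y) * (log2 y + log2 (INR p - 1) - log2 (1 - y)) by apply: Rmult_le_pos; lra.
have e : (1 - x - (1 - y)) / ln 2 = - ((x - y) / ln 2) by field; have := ln2_gt0; lra.
rewrite e in h1; lra.
Qed.

Lemma Tp_le_inv (p : nat) (x y : R) :
  2 <= INR p -> / INR p <= y -> x <= 1 -> Tp p y <= Tp p x -> x <= y.
Proof.
move=> p2 py x1 h; case: (Rle_lt_dec x y) => // yx.
by have := Tp_decr p2 py yx x1; lra.
Qed.

Lemma Tp_invp (p : nat) : 2 <= INR p -> Tp p (/ INR p) = log2 (INR p).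
Proof.
move=> p2; have p0 : 0 < / INR p by apply: Rinv_0_lt_compat; lra.
have e : 1 - / INR p = (INR p - 1) * / INR p by field; lra.
have p1 : 0 < (INR p - 1) * / INR p by apply: Rmult_lt_0_compat; lra.
rewrite /Tp /hbin e !xlog2xE // log2M //; last lra.
rewrite log2V; last lra.
by field; lra.
Qed.

(** An explicit substitute for continuity of [Tp] at 1. Evaluating at [1 - s * s] turns the singular
    term into [2 s (s ln s)], and [s ln s] is bounded, so the whole bound is linear in [s]. *)
Lemma Tp_small (p : nat) (s : R) : 2 <= INR p -> 0 < s -> s <= / 2 ->
  Tp p (1 - s * s) < s * ((4 + ln (INR p)) / ln 2).
Proof.
move=> p2 s0 s2; have l2 := ln2_gt0; rewrite /Tp /hbin.
have ss : 0 < s * s by apply: Rmult_lt_0_compat.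
have ss2 : s * s <= s * / 2 by apply: Rmult_le_compat_l; lra.
have -> : 1 - (1 - s * s) = s * s by ring.
rewrite !xlog2xE; try lra; rewrite log2M //.
have h1 : - ((1 - s * s) * ln (1 - s * s)) <= s.
  have q : 0 < / (1 - s * s) by apply: Rinv_0_lt_compat; lra.
  have : / (1 - s * s) <> 1 by move=> h; have := Rinv_l (1 - s * s); rewrite h; lra.
  move/(ln_lt_sub1 q); rewrite ln_Rinv; last lra.
  move=> h; have : (1 - s * s) * - ln (1 - s * s) <= (1 - s * s) * (/ (1 - s * s) - 1).
    by apply: Rmult_le_compat_l; lra.
  by rewrite Rmult_minus_distr_l Rinv_r; lra.
have h2 : - (s * ln s) < 1.
  have q : 0 < / s by exact: Rinv_0_lt_compat.
  have : / s <> 1 by move=> h; have := Rinv_l s; rewrite h; lra.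
  move/(ln_lt_sub1 q); rewrite ln_Rinv //.
  move=> h; have : s * - ln s < s * (/ s - 1) by apply: Rmult_lt_compat_l; lra.
  by rewrite Rmult_minus_distr_l Rinv_r; lra.
have h3 : s * - (s * ln s) <= s * 1 by apply: Rmult_le_compat_l; lra.
have h4 : ln (INR p - 1) <= ln (INR p) by apply: ln_le; lra.
have h5 : 0 <= ln (INR p) by rewrite -ln_1; apply: ln_le; lra.
have h6 : s * s * ln (INR p - 1) <= s * ln (INR p).
  apply: (Rle_trans _ (s * s * ln (INR p))); first by apply: Rmult_le_compat_l; lra.
  by apply: Rmult_le_compat_r; lra.
(* After clearing [ln 2], the three terms contribute at most [s], [2 s] and [s ln p]; the constant 4
   instead of 3 makes the inequality strict. *)
apply: (Rmult_lt_reg_r (ln 2)) => //; rewrite /log2.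
set A := ln (1 - _) in h1 *; set B := ln s in h2 h3 *; set C := ln (INR p - 1) in h4 h6 *.
set D := ln (INR p) in h4 h5 h6 *.
have -> : (- ((1 - s * s) * (A / ln 2)) - s * s * (B / ln 2 + B / ln 2) + s * s * (C / ln 2)) * ln 2
  = - ((1 - s * s) * A) + 2 * (s * - (s * B)) + s * s * C by field; lra.
have -> : s * ((4 + D) / ln 2) * ln 2 = s * 4 + s * D by field; lra.
lra.
Qed.

Lemma Tp_continuous (p : nat) (x : R) : 0 < x < 1 -> continuity_pt (Tp p) x.
Proof.
move=> x01; apply: (continuity_pt_ext_loc (fun x => - (x * (ln x / ln 2)) -
    (1 - x) * (ln (1 - x) / ln 2) + (1 - x) * log2 (INR p - 1))).
  have e0 : 0 < Rmin x (1 - x) by apply: Rmin_pos; lra.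
  (* Within this radius both [y] and [1 - y] stay positive, so the case distinction in [xlog2x]
     disappears. *)
  exists (mkposreal _ e0) => y /= /Rabs_lt_between'; rewrite /Tp /hbin /log2.
  have := Rmin_l x (1 - x); have := Rmin_r x (1 - x) => h1 h2 h3.
  by rewrite !xlog2xE //; lra.
apply/continuity_pt_filterlim; apply: ex_derive_continuous.
by auto_derive; have := ln2_gt0; repeat split; lra.
Qed.

(** Since [Tp_inv] is an [epsilon], the point is the existence of a preimage. The value 0 is
    attained at 1; a positive [z] is reached by the intermediate value theorem on an interval that
    stops short of 1. *)
Lemma Tp_inv_spec (p : nat) (z : R) : 2 <= INR p -> 0 <= z -> z < log2 (INR p) ->
  / INR p <= Tp_inv p z <= 1 /\ Tp p (Tp_inv p z) = z.
Proof.
move=> p2 z0 zp; rewrite /Tp_inv.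
apply: (epsilon_spec (inhabits 0) (fun y => / INR p <= y <= 1 /\ Tp p y = z)).
have l2 := ln2_gt0.
have ip : / INR p <= / 2 by apply: Rinv_le_contravar; lra.
have ip0 : 0 < / INR p by apply: Rinv_0_lt_compat; lra.
case: (Rle_lt_or_eq_dec _ _ z0) => [zpos|<-]; last first.
  exists 1; split; first lra.
  by rewrite /Tp /hbin Rminus_diag xlog2x0 xlog2xE /log2 ?ln_1; lra.
have h5 : 0 <= ln (INR p) by rewrite -ln_1; apply: ln_le; lra.
have Kpos : 0 < (4 + ln (INR p)) / ln 2 by apply: Rdiv_lt_0_compat; lra.
set K := (_ / ln 2) in Kpos.
(* The bound [/ 2] meets the hypothesis of [Tp_small] and keeps [1 - s * s] to the right of
   [/ INR p]; the bound [z / K] forces [Tp] at [1 - s * s] below [z]. *)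
pose s := Rmin (/ 2) (z / K).
have s0 : 0 < s by apply: Rmin_pos; [lra | exact: Rdiv_lt_0_compat].
have s2 : s <= / 2 by exact: Rmin_l.
have sz : s * K <= z.
  have -> : z = z / K * K by field; lra.
  by apply: Rmult_le_compat_r; [lra | exact: Rmin_r].
have := Tp_small p2 s0 s2; rewrite -/K => hs.
have ss : 0 < s * s by apply: Rmult_lt_0_compat.
have ss2 : s * s <= s * / 2 by apply: Rmult_le_compat_l; lra.
case: (Ranalysis5.IVT_interv (fun x => z - Tp p x) (/ INR p) (1 - s * s)).
- move=> a ha; apply: continuity_pt_minus; first by apply: continuity_pt_const.
  by apply: Tp_continuous; lra.
- lra.
- by rewrite Tp_invp //; lra.
- lra.
- by move=> y [hy ey]; exists y; split; lra.
Qed.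

(** * Finite sums and Fourier inversion on Z_p *)

(** These instances, and those for [Cx] below, make the generic big-operator lemmas (exchange,
    reindexing, distributivity) apply to [rsum], [rprod] and [Csum]. *)
HB.instance Definition _ := Monoid.isComLaw.Build R 0 Rplus
  (fun x y z => esym (Rplus_assoc x y z)) Rplus_comm Rplus_0_l.
HB.instance Definition _ := Monoid.isComLaw.Build R 1 Rmult
  (fun x y z => esym (Rmult_assoc x y z)) Rmult_comm Rmult_1_l.
HB.instance Definition _ := Monoid.isMulLaw.Build R 0 Rmult Rmult_0_l Rmult_0_r.
HB.instance Definition _ := Monoid.isAddLaw.Build R Rmult Rplus
  (fun x y z => Rmult_plus_distr_r x y z) (fun x y z => Rmult_plus_distr_l x y z).

Lemma CaddA : associative Cadd.
Proof. by move=> [a b] [c d] [e f]; rewrite /Cadd /= !Rplus_assoc. Qed.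
Lemma CaddC : commutative Cadd.
Proof. by move=> [a b] [c d]; rewrite /Cadd /= Rplus_comm (Rplus_comm b). Qed.
Lemma Cadd0 : left_id (0, 0) Cadd.
Proof. by move=> [a b]; rewrite /Cadd /= !Rplus_0_l. Qed.
Lemma CmulA : associative Cmul.
Proof. by move=> [a b] [c d] [e f]; rewrite /Cmul /=; congr pair; ring. Qed.
Lemma CmulC : commutative Cmul.
Proof. by move=> [a b] [c d]; rewrite /Cmul /=; congr pair; ring. Qed.
Lemma Cmul1 : left_id (1, 0) Cmul.
Proof. by move=> [a b]; rewrite /Cmul /=; congr pair; ring. Qed.
Lemma Cmul0z : left_zero (0, 0) Cmul.
Proof. by move=> [a b]; rewrite /Cmul /=; congr pair; ring. Qed.
Lemma Cmulz0 : right_zero (0, 0) Cmul.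
Proof. by move=> [a b]; rewrite /Cmul /=; congr pair; ring. Qed.
Lemma CmulDl : left_distributive Cmul Cadd.
Proof. by move=> [a b] [c d] [e f]; rewrite /Cmul /Cadd /=; congr pair; ring. Qed.
Lemma CmulDr : right_distributive Cmul Cadd.
Proof. by move=> [a b] [c d] [e f]; rewrite /Cmul /Cadd /=; congr pair; ring. Qed.

HB.instance Definition _ := Monoid.isComLaw.Build Cx (0, 0) Cadd CaddA CaddC Cadd0.
HB.instance Definition _ := Monoid.isComLaw.Build Cx (1, 0) Cmul CmulA CmulC Cmul1.
HB.instance Definition _ := Monoid.isMulLaw.Build Cx (0, 0) Cmul Cmul0z Cmulz0.
HB.instance Definition _ := Monoid.isAddLaw.Build Cx Cmul Cadd CmulDl CmulDr.

Lemma rsum_ge0 (I : finType) (P : pred I) (F : I -> R) :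
  (forall i, P i -> 0 <= F i) -> 0 <= \big[Rplus/0]_(i | P i) F i.
Proof. by move=> h; elim/big_ind: _ => //; [lra | move=> x y; lra]. Qed.

Lemma rprod_ge0 (I : finType) (F : I -> R) :
  (forall i, 0 <= F i) -> 0 <= \big[Rmult/1]_i F i.
Proof. by move=> h; elim/big_ind: _ => //; [lra | exact: Rmult_le_pos]. Qed.

Lemma rsum_le (I : finType) (P : pred I) (F G : I -> R) :
  (forall i, P i -> F i <= G i) ->
  \big[Rplus/0]_(i | P i) F i <= \big[Rplus/0]_(i | P i) G i.
Proof. by move=> h; elim/big_ind2: _ => //; [lra | move=> x1 x2 y1 y2; lra]. Qed.

Lemma rsum_const (I : finType) (x : R) : \big[Rplus/0]_(i : I) x = INR #|I| * x.
Proof.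
rewrite big_const; elim: #|I| => [|n IH]; first by rewrite /= Rmult_0_l.
by rewrite iterS IH S_INR; ring.
Qed.

Lemma omega_powD (p a b : nat) :
  omega_pow p (a + b) = Cmul (omega_pow p a) (omega_pow p b).
Proof.
rewrite /omega_pow /Cmul /= plus_INR.
have -> : 2 * PI * (INR a + INR b) / INR p = 2 * PI * INR a / INR p + 2 * PI * INR b / INR p.
  by rewrite /Rdiv; ring.
by rewrite cos_plus sin_plus; congr pair; ring.
Qed.

Lemma omega_pow0 (p : nat) : omega_pow p 0 = (1, 0).
Proof. by rewrite /omega_pow /= Rmult_0_r /Rdiv Rmult_0_l cos_0 sin_0. Qed.

Lemma omega_pow_period (p q : nat) : (0 < p)%N -> omega_pow p (q * p) = (1, 0).
Proof.
move=> p0; have pn : INR p <> 0 by apply: not_0_INR => h; rewrite h in p0.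
rewrite /omega_pow mult_INR.
have -> : 2 * PI * (INR q * INR p) / INR p = 0 + 2 * INR q * PI by field.
by rewrite cos_period sin_period cos_0 sin_0.
Qed.

Lemma omega_pow_mod (p e : nat) : (0 < p)%N -> omega_pow p (e %% p) = omega_pow p e.
Proof.
by move=> p0; rewrite [in RHS](divn_eq e p) omega_powD omega_pow_period // Cmul1.
Qed.

(** By [cos (2 a) = 1 - 2 sin a ^ 2] with [a] strictly between 0 and [PI]. This shows that
    [1 - omega ^ d] is nonzero, hence can be cancelled. *)
Lemma omega_pow_re_lt1 (p d : nat) : (0 < p)%N -> ~~ (p %| d)%N -> (omega_pow p d).1 < 1.
Proof.
move=> p0 pd; rewrite -(omega_pow_mod d p0).
have rp : (d %% p < p)%N by rewrite ltn_mod.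
have r0 : (0 < d %% p)%N by rewrite lt0n.
move/ltP/lt_INR: rp; move/ltP/lt_INR: r0 => /= r0 rp; move: p0 => /ltP/lt_INR /= p0.
set r := INR (d %% p) in r0 rp *.
have rp1 : r / INR p < 1.
  by apply: (Rmult_lt_reg_r (INR p)) => //; rewrite Rmult_1_l /Rdiv Rmult_assoc Rinv_l; lra.
have rp0 : 0 < r / INR p by exact: Rdiv_lt_0_compat.
have -> : 2 * PI * r / INR p = 2 * (PI * (r / INR p)) by field; lra.
have pi0 := PI_RGT_0.
have s0 : 0 < sin (PI * (r / INR p)).
  apply: sin_gt_0; first exact: Rmult_lt_0_compat.
  by rewrite -[X in _ < X]Rmult_1_r; apply: Rmult_lt_compat_l.
by rewrite cos_2a_sin; have := Rmult_lt_0_compat _ _ s0 s0; lra.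
Qed.

(** Orthogonality of characters. If [d] is not a multiple of the modulus, multiplying the sum by
    [omega ^ d] only shifts [k] by one, so the sum is fixed by a factor different from 1 and
    vanishes. The modulus is written [p'.+2] so that the ordinals carry their ring structure. *)
Lemma sum_omega_pow (p' d : nat) :
  \big[Cadd/(0,0)]_(k : 'I_p'.+2) omega_pow p'.+2 (d * k) =
  if (p'.+2 %| d)%N then (INR p'.+2, 0) else (0, 0).
Proof.
case: ifP => [/dvdnP [q ->]|/negbT pd].
  transitivity (\big[Cadd/(0,0)]_(k : 'I_p'.+2) (1, 0)).
    by apply: eq_bigr => k _; rewrite mulnAC omega_pow_period.
  rewrite big_const card_ord; elim: (p'.+2) => // n IH.
  by rewrite iterS IH S_INR /Cadd /=; congr pair; ring.
set S := LHS.
have zS : Cmul (omega_pow p'.+2 d) S = S.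
  rewrite /S big_distrr /= [RHS](reindex_inj (@GRing.addrI _ (1%R : 'I_p'.+2))) /=.
  apply: eq_bigr => k _.
  rewrite -omega_powD -[RHS]omega_pow_mod // modnMmr omega_pow_mod //.
  by congr omega_pow; rewrite mulnDr muln1.
move: zS (omega_pow_re_lt1 (isT : (0 < p'.+2)%N) pd).
case: (omega_pow _ _) S => [c s] [a b]; rewrite /Cmul /= => -[e1 e2] c1.
(* This is the squared modulus of [1 - (c + i s)]; multiplying by the conjugate solves the two real
   equations for [a] and [b]. *)
have q0 : (1 - c) * (1 - c) + s * s <> 0.
  have := Rmult_lt_0_compat (1 - c) (1 - c) ltac:(lra) ltac:(lra).
  have := Rle_0_sqr s; rewrite /Rsqr; lra.
congr pair.
  apply: (Rmult_eq_reg_l _ _ _ _ q0).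
  have -> : ((1 - c) * (1 - c) + s * s) * a =
    (1 - c) * (a - (c * a - s * b)) - s * (b - (c * b + s * a)) by ring.
  by rewrite e1 e2; ring.
apply: (Rmult_eq_reg_l _ _ _ _ q0).
have -> : ((1 - c) * (1 - c) + s * s) * b =
  (1 - c) * (b - (c * b + s * a)) + s * (a - (c * a - s * b)) by ring.
by rewrite e1 e2; ring.
Qed.

(** The [n]-fold convolution of [nu]: the law of a sum of [n] independent variables distributed as
    [nu]. *)
Definition sum_law (p' n : nat) (nu : 'I_p'.+2 -> R) (w : 'I_p'.+2) : R :=
  \big[Rplus/0]_(e : {ffun 'I_n -> 'I_p'.+2} | (\sum_t e t)%R == w)
    \big[Rmult/1]_t nu (e t).

Lemma sum_law_ge0 (p' n : nat) (nu : 'I_p'.+2 -> R) w :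
  (forall j, 0 <= nu j) -> 0 <= sum_law n nu w.
Proof. by move=> h; apply: rsum_ge0 => e _; apply: rprod_ge0. Qed.

Lemma sum_law_total (p' n : nat) (nu : 'I_p'.+2 -> R) :
  \big[Rplus/0]_j nu j = 1 -> \big[Rplus/0]_w sum_law n nu w = 1.
Proof.
move=> h; transitivity (\big[Rmult/1]_(t < n) \big[Rplus/0]_j nu j); last by rewrite big1.
rewrite bigA_distr_bigA /=.
by rewrite (partition_big (fun e : {ffun 'I_n -> 'I_p'.+2} => \sum_t e t)%R xpredT).
Qed.

Lemma Cpow_big (z : Cx) (n : nat) : Cpow z n = \big[Cmul/(1,0)]_(t < n) z.
Proof. by elim: n => [|n IH]; rewrite ?big_ord0 // big_ord_recl -IH. Qed.

Lemma CscaleE (a : R) (z : Cx) : Cscale a z = Cmul (a, 0) z.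
Proof. by case: z => x y; rewrite /Cscale /Cmul /=; congr pair; ring. Qed.

Lemma rprod_real (I : finType) (F : I -> R) :
  \big[Cmul/(1,0)]_i (F i, 0) = (\big[Rmult/1]_i F i, 0).
Proof.
by elim/big_rec2: _ => // i x y _ ->; rewrite /Cmul /=; congr pair; ring.
Qed.

Lemma rsum_real (I : finType) (P : pred I) (F : I -> R) :
  \big[Cadd/(0,0)]_(i | P i) (F i, 0) = (\big[Rplus/0]_(i | P i) F i, 0).
Proof.
by elim/big_rec2: _ => // i x y _ ->; rewrite /Cadd /=; congr pair; ring.
Qed.

Lemma prod_omega_pow (I : finType) (p : nat) (e : I -> nat) :
  \big[Cmul/(1,0)]_i omega_pow p (e i) = omega_pow p (\sum_i e i).
Proof.
by elim/big_rec2: _ => [|i x y _ ->]; rewrite ?omega_pow0 ?omega_powD.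
Qed.

Lemma natr_sum_Zp (p' : nat) (I : finType) (e : I -> 'I_p'.+2) :
  ((\sum_i e i)%N%:R = \sum_i e i)%R.
Proof. by rewrite GRing.natr_sum; apply: eq_bigr => i _; rewrite natr_Zp. Qed.

Lemma dvdn_Zp (p' n : nat) : (p'.+2 %| n)%N = (n%:R == 0 :> 'I_p'.+2)%R.
Proof. by rewrite Zp_nat /dvdn. Qed.

Local Arguments INR : simpl never.
Local Arguments pow : simpl never.

(** Fourier inversion: expanding the power over all error vectors [e] leaves the phase
    [omega ^ ((c + sum e) k)], and summing over [k] first selects the vectors whose sum is [- c]. *)
Lemma lhs_sum_law (p' : nat) (Hp : (0 < p'.+2)%N) (P : box p'.+2) (n : nat)
    (c : 'I_p'.+2) :
  lhs Hp P n c = (sum_law n.-1 (mu Hp P) (- c)%R, 0).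
Proof.
rewrite /lhs /Csum /sum_law; set nu := mu Hp P.
under eq_bigr => k _.
  rewrite Cpow_big bigA_distr_bigA /=.
  under eq_bigr => e _.
    under eq_bigr => t _ do rewrite CscaleE.
    rewrite big_split /= rprod_real prod_omega_pow -big_distrl /=.
    over.
  rewrite big_distrr /=.
  under eq_bigr => e _ do rewrite CmulA (CmulC (omega_pow _ _)) -CmulA -omega_powD -mulnDl.
  over.
rewrite exchange_big /= CscaleE big_distrr /= [in RHS]big_mkcond -rsum_real /=.
apply: eq_bigr => e _; rewrite -big_distrr /= sum_omega_pow dvdn_Zp.
rewrite GRing.natrD natr_Zp natr_sum_Zp GRing.addrC GRing.addr_eq0.
case: ifP => _; last by rewrite !Cmulz0.
by rewrite /Cmul; cbn [fst snd]; congr pair; field; apply: not_0_INR.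
Qed.

(** * Mutual information and Fano's inequality *)

Lemma sum_subr (p' : nat) (F : 'I_p'.+2 -> R) (u : 'I_p'.+2) :
  \big[Rplus/0]_v F (u - v)%R = \big[Rplus/0]_w F w.
Proof. by rewrite [RHS](reindex_inj (@GRing.subrI _ u)). Qed.

Lemma sum_subl (p' : nat) (F : 'I_p'.+2 -> R) (v : 'I_p'.+2) :
  \big[Rplus/0]_u F (u - v)%R = \big[Rplus/0]_w F w.
Proof. by rewrite [RHS](reindex_inj (@GRing.addIr _ (- v)%R)). Qed.

(** Both marginals are uniform, so the logarithm is that of [p W (u - v)], with [p] the modulus. The
    result is [log2 p] minus the entropy of the noise [W]. *)
Lemma mutinf_additive_noise (p' : nat) (J : 'I_p'.+2 -> 'I_p'.+2 -> R) (W : 'I_p'.+2 -> R) :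
  (forall w, 0 <= W w) -> \big[Rplus/0]_w W w = 1 ->
  (forall u v, J u v = / INR p'.+2 * W (u - v)%R) ->
  mutinf J = log2 (INR p'.+2) + \big[Rplus/0]_w xlog2x (W w).
Proof.
move=> W0 W1 JE; rewrite /mutinf /rsum.
have p0 : 0 < INR p'.+2 by apply: lt_0_INR; apply/ltP.
have ip0 := Rinv_0_lt_compat _ p0.
transitivity (\big[Rplus/0]_u \big[Rplus/0]_v (/ INR p'.+2 *
    (W (u - v)%R * log2 (INR p'.+2) + xlog2x (W (u - v)%R)))).
  apply: eq_bigr => u _; apply: eq_bigr => v _.
  rewrite (eq_bigr _ (fun v' _ => JE u v')) (eq_bigr _ (fun u' _ => JE u' v)) -!big_distrr /=.
  rewrite sum_subr sum_subl W1 JE.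
  move: (W (u - v)%R) (W0 (u - v)%R) => x x0.
  case: (Rle_lt_or_eq_dec _ _ x0) => [h|<-]; last first.
    by rewrite xlog2x0; case: Rlt_dec => h /=; lra.
  have h' := Rmult_lt_0_compat _ _ ip0 h.
  case: Rlt_dec => //= _; rewrite xlog2xE //.
  have -> : / INR p'.+2 * x / (/ INR p'.+2 * 1 * (/ INR p'.+2 * 1)) = INR p'.+2 * x.
    by field; lra.
  by rewrite log2M //; ring.
under eq_bigr => u _.
  rewrite (sum_subr (fun w => / INR p'.+2 * (W w * log2 (INR p'.+2) + xlog2x (W w)))).
  rewrite -big_distrr big_split -big_distrl /= W1.
  over.
by rewrite rsum_const card_ord -Rmult_assoc Rinv_r ?Rmult_1_l //; lra.
Qed.

Lemma rsumD1 (I : finType) (i0 : I) (F : I -> R) :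
  \big[Rplus/0]_i F i = F i0 + \big[Rplus/0]_(i | i != i0) F i.
Proof. exact: bigD1. Qed.

(** Fano's inequality: with the mass of [w0] fixed, the entropy is largest when the remaining mass
    is spread evenly. This follows from Gibbs' inequality against that even distribution. *)
Lemma entropy_le_Tp (p' : nat) (W : 'I_p'.+2 -> R) (w0 : 'I_p'.+2) :
  (forall w, 0 <= W w) -> \big[Rplus/0]_w W w = 1 ->
  - (\big[Rplus/0]_w xlog2x (W w)) <= Tp p'.+2 (W w0).
Proof.
move=> W0 W1; rewrite (rsumD1 w0) /Tp /hbin.
move: W1; rewrite (rsumD1 w0) => W1.
have rest : \big[Rplus/0]_(w | w != w0) W w = 1 - W w0 by lra.
have p1 : 1 <= INR p'.+1 by apply: (le_INR 1); apply/leP.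
suff : xlog2x (1 - W w0) - (1 - W w0) * log2 (INR p'.+2 - 1) <=
       \big[Rplus/0]_(w | w != w0) xlog2x (W w) by lra.
have -> : INR p'.+2 - 1 = INR p'.+1 by rewrite S_INR; ring.
have r0 : 0 <= 1 - W w0 by rewrite -rest; exact: rsum_ge0.
(* If [w0] carries all the mass, the comparison value would be 0 and [gibbs_le] would not apply; all
   the other weights then vanish. *)
case: (Rle_lt_or_eq_dec _ _ r0) => [rp|e]; last first.
  rewrite -e xlog2x0 big1; first lra.
  move=> w ne; have := rest; rewrite (bigD1 w) //= -e.
  set T := \big[_/_]_(_ | _) _ => h; have T0 : 0 <= T by exact: rsum_ge0.
  by have := W0 w => Ww; have -> : W w = 0; [lra | exact: xlog2x0].
set r := 1 - W w0 in rest r0 rp *.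
(* The even share of each of the other outcomes; with it the linear corrections [(W w - t) / ln 2]
   sum to zero. *)
pose t := r / INR p'.+1.
have t0 : 0 < t by apply: Rdiv_lt_0_compat; lra.
apply: (Rle_trans _ (\big[Rplus/0]_(w | w != w0)
    (W w * (log2 t + / ln 2) + - (t / ln 2)))); last first.
  apply: rsum_le => w _; have := gibbs_le (W0 w) t0; rewrite /Rdiv; lra.
rewrite big_split -big_distrl /= rest.
have -> : \big[Rplus/0]_(w : 'I_p'.+2 | w != w0) - (t / ln 2) = INR p'.+1 * - (t / ln 2).
  apply: (Rplus_eq_reg_l (- (t / ln 2))).
  by rewrite -(rsumD1 w0 (fun=> - (t / ln 2))) rsum_const card_ord S_INR; ring.
have -> : INR p'.+1 * - (t / ln 2) = - (r / ln 2).
  by rewrite /t; field; split; [have := ln2_gt0; lra | lra].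
rewrite xlog2xE // /t /Rdiv log2M //; last by apply: Rinv_0_lt_compat; lra.
rewrite log2V; lra.
Qed.

(** * The random access code *)

From mathcomp Require Import ring.

Lemma sum_enum_val (T : finType) (F : T -> R) :
  \big[Rplus/0]_(k < #|T|) F (enum_val k) = \big[Rplus/0]_x F x.
Proof. by rewrite [RHS](reindex _ (onW_bij _ (@enum_val_bij T))). Qed.

Lemma sum_tuple_ffun (T : finType) (n : nat) (F : n.-tuple T -> R) :
  \big[Rplus/0]_a F a = \big[Rplus/0]_(f : {ffun 'I_n -> T}) F [tuple f i | i < n].
Proof.
rewrite (reindex (fun f : {ffun 'I_n -> T} => [tuple f i | i < n])) //.
exists (fun a : n.-tuple T => [ffun i => tnth a i]) => [f|a] _.
  by apply/ffunP => i; rewrite ffunE tnth_mktuple.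
by apply: eq_from_tnth => i; rewrite tnth_mktuple ffunE.
Qed.

Lemma sum_ffun_pair (I A B : finType) (F : {ffun I -> A} -> {ffun I -> B} -> R) :
  \big[Rplus/0]_f \big[Rplus/0]_g F f g =
  \big[Rplus/0]_(h : {ffun I -> A * B}) F [ffun i => (h i).1] [ffun i => (h i).2].
Proof.
rewrite pair_bigA /= (reindex (fun h : {ffun I -> A * B} =>
  ([ffun i => (h i).1] : {ffun I -> A}, [ffun i => (h i).2] : {ffun I -> B}))) //=.
exists (fun fg : {ffun I -> A} * {ffun I -> B} => [ffun i => (fg.1 i, fg.2 i)]) => [h|[f g]] _.
  by apply/ffunP => i; rewrite !ffunE; case: (h i).
by congr pair; apply/ffunP => i; rewrite !ffunE.
Qed.

(** Change of variables for a product measure: applying [phi] coordinatewise gives the product of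
    the pushforwards of [w]. *)
Lemma sum_ffun_map (I Z E : finType) (phi : Z -> E) (w : Z -> R) (G : {ffun I -> E} -> R) :
  \big[Rplus/0]_(h : {ffun I -> Z}) (G [ffun t => phi (h t)] * \big[Rmult/1]_t w (h t)) =
  \big[Rplus/0]_e (G e * \big[Rmult/1]_t \big[Rplus/0]_(z | phi z == e t) w z).
Proof.
rewrite (partition_big (fun h : {ffun I -> Z} => [ffun t => phi (h t)]) xpredT) //=.
apply: eq_bigr => e _; rewrite bigA_distr_big_dep big_distrr /=.
apply: eq_big => [h|h /eqP <-] //.
apply/eqP/familyP => [<- t|H]; first by rewrite ffunE; apply: eqxx.
by apply/ffunP => t; rewrite ffunE; apply/eqP; exact: H.
Qed.

Lemma card_ffun_at (p' n : nat) (i : 'I_n.+1) (u : 'I_p'.+2) :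
  \big[Rplus/0]_(xv : {ffun 'I_n.+1 -> 'I_p'.+2} | xv i == u) / (INR p'.+2 ^ n.+1) = / INR p'.+2.
Proof.
have p0 : INR p'.+2 <> 0 by exact: not_0_INR.
(* The constraint on coordinate [i] is absorbed into its factor, so the sum becomes a product of
   one-coordinate sums, all equal to 1 except the one at [i]. *)
pose h (j : 'I_n.+1) (z : 'I_p'.+2) : R :=
  if (j != i) || (z == u) then / INR p'.+2 else 0.
transitivity (\big[Rplus/0]_(xv : {ffun 'I_n.+1 -> 'I_p'.+2}) \big[Rmult/1]_j h j (xv j)).
  rewrite big_mkcond; apply: eq_bigr => xv _; case: eqP => [e|/eqP e].
    transitivity (\big[Rmult/1]_(j < n.+1) / INR p'.+2).
      rewrite big_const card_ord; elim: (n.+1) => [|k IH]; first by rewrite Rinv_1.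
      by rewrite iterS -IH -Rinv_mult.
    by apply: eq_bigr => j _; rewrite /h; case: eqP => //= ->; rewrite e eqxx.
  by rewrite (bigD1 i) //= /h eqxx (negPf e) /= Rmult_0_l.
rewrite -bigA_distr_bigA (bigD1 i) //= [X in _ * X]big1.
  rewrite (bigD1 u) //= big1; first by rewrite /h eqxx /= eqxx Rplus_0_r Rmult_1_r.
  by move=> z /negPf e; rewrite /h e eqxx.
move=> j e; rewrite /h e /= rsum_const card_ord.
by rewrite Rinv_r.
Qed.

(** Here [z] is [((x, y), (a, b))], and the value is the deviation of the box from the ideal
    relation [b = a - x y]. *)
Definition box_error (p' : nat) (z : ('I_p'.+2 * 'I_p'.+2) * ('I_p'.+2 * 'I_p'.+2)) : 'I_p'.+2 :=
  (z.2.2 - z.2.1 + z.1.1 * z.1.2)%R.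

Lemma mu_box_error (p' : nat) (Hp : (0 < p'.+2)%N) (P : box p'.+2) (j : 'I_p'.+2) :
  mu Hp P j = \big[Rplus/0]_(z | box_error z == j)
    (/ (INR p'.+2 ^ 2) * P z.2.1 z.2.2 z.1.1 z.1.2).
Proof.
rewrite /mu /rsum -big_distrr /=; congr Rmult.
transitivity (\big[Rplus/0]_(xy : 'I_p'.+2 * 'I_p'.+2) \big[Rplus/0]_(ab : 'I_p'.+2 * 'I_p'.+2)
   if box_error (xy, ab) == j then P ab.1 ab.2 xy.1 xy.2 else 0); last first.
  by rewrite pair_bigA [RHS]big_mkcond; apply: eq_bigr => -[xy ab].
rewrite pair_bigA; apply: eq_bigr => -[x y] _ /=.
transitivity (\big[Rplus/0]_a \big[Rplus/0]_b
   if box_error ((x, y), (a, b)) == j then P a b x y else 0); last first.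
  by rewrite pair_bigA; apply: eq_bigr => -[a b].
apply: eq_bigr => a _; rewrite -big_mkcond /=.
(* Given [x], [y] and [a], exactly one [b] produces the error [j]; it is the index that [mu]
   computes in [nat] through [zmodp]. *)
rewrite (big_pred1 (a - x * y + j)%R).
  congr (P _ _ _ _); apply: val_inj; rewrite /= modnDml.
  by rewrite [in RHS]addnAC modnDmr addnAC.
move=> b; rewrite /box_error /=.
by apply/eqP/eqP => [<-|->]; ring.
Qed.

(** Bridges the [nat]-indexed rounds of a [protocol] and ordinal-indexed families; [x0] is returned
    only out of range. *)
Definition at_nat (n : nat) (T : Type) (x0 : T) (f : 'I_n -> T) (t : nat) : T :=
  oapp f x0 (insub t).

Lemma at_nat_ord (n : nat) (T : Type) (x0 : T) (f : 'I_n -> T) (t : 'I_n) :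
  at_nat x0 f t = f t.
Proof. by rewrite /at_nat valK. Qed.

Section RandomAccessCode.

Variables (p' n : nat).
Notation Zp := 'I_p'.+2.
Notation twirl := {ffun 'I_n -> Zp * Zp}.

Definition alice_in (xv : {ffun 'I_n.+1 -> Zp}) (rho : twirl) (t : 'I_n) : Zp :=
  (xv (lift ord0 t) - xv ord0 + (rho t).1)%R.

Definition bob_sel (y : 'I_n.+1) (t : 'I_n) : Zp := ((y == lift ord0 t)%:R)%R.

Definition bob_in (y : 'I_n.+1) (rho : twirl) (t : 'I_n) : Zp :=
  (bob_sel y t + (rho t).2)%R.

(** A non-adaptive strategy: box inputs ignore earlier outputs. The shared randomness enumerates all
    masks, each weighted uniformly. *)
Definition rac_protocol : protocol n.+1 p'.+2 :=
  @Protocol n.+1 p'.+2 #|{: twirl}|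
    (fun _ => \big[Rmult/1]_(t < n) / (INR p'.+2 ^ 2)) n
    (fun t xv r _ => at_nat 0%R (alice_in xv (enum_val r)) t)
    (fun xv r a => xv ord0 +
       \sum_t (tnth a t - alice_in xv (enum_val r) t * (enum_val r t).2))%R
    (fun t y _ r _ => at_nat 0%R (bob_in y (enum_val r)) t)
    (fun y q r b => q - \sum_t (tnth b t + (enum_val r t).1 * bob_sel y t))%R.

Lemma select_coord (xv : {ffun 'I_n.+1 -> Zp}) (y : 'I_n.+1) :
  (xv ord0 + \sum_t (xv (lift ord0 t) - xv ord0) * bob_sel y t = xv y)%R.
Proof.
rewrite /bob_sel; case: (unliftP ord0 y) => [s|] ->.
  rewrite (bigD1 s) //= eqxx big1 => [|t /negPf e].
    by rewrite GRing.mulr1 GRing.addr0 GRing.addrC GRing.subrK.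
  by rewrite (inj_eq (@lift_inj _ ord0)) eq_sym e GRing.mulr0.
by rewrite big1 ?GRing.addr0 // => t _; rewrite (negPf (neq_lift _ _)) GRing.mulr0.
Qed.

(** The masked product splits into the wanted product, [alice_in * (rho t).2], which Alice can
    subtract, and [(rho t).1 * bob_sel], which Bob can subtract. Only the box errors remain. *)
Lemma rac_guess (xv : {ffun 'I_n.+1 -> Zp}) (y : 'I_n.+1) (rho : twirl) (a b : 'I_n -> Zp) :
  (xv ord0 + \sum_t (a t - alice_in xv rho t * (rho t).2)
   - \sum_t (b t + (rho t).1 * bob_sel y t) =
   xv y - \sum_t box_error ((alice_in xv rho t, bob_in y rho t), (a t, b t)))%R.
Proof.
rewrite -[in RHS](select_coord xv y) -!GRing.addrA; congr (_ + _)%R.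
rewrite -!GRing.sumrB; apply: eq_bigr => t _.
by rewrite /box_error /alice_in /bob_in /=; ring.
Qed.

Lemma rac_valid : valid_protocol rac_protocol.
Proof.
have p0 : 0 < INR p'.+2 by apply: lt_0_INR; apply/ltP.
split=> [r|]; rewrite /rsum /=.
  by apply: rprod_ge0 => t; apply/Rlt_le/Rinv_0_lt_compat; exact: pow_lt.
rewrite (sum_enum_val (fun _ : twirl => \big[Rmult/1]_(t < n) / (INR p'.+2 ^ 2))).
rewrite -(bigA_distr_bigA (fun (_ : 'I_n) (_ : Zp * Zp) => / (INR p'.+2 ^ 2))) big1 // => t _.
rewrite rsum_const card_prod !card_ord.
by rewrite mult_INR /pow Rmult_1_r Rinv_r //; apply: Rmult_integral_contrapositive; lra.
Qed.

(* For fixed [xv] and [y], shifting the twirl by the unmasked inputs makes the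
   [n] box uses independent with uniform inputs, so that the errors are
   independent with law [mu]. *)
Lemma rac_guess_law (Hp : (0 < p'.+2)%N) (P : box p'.+2) xv (y : 'I_n.+1) (v : Zp) :
  rsum (fun r : 'I_(nr rac_protocol) => Defs.pi rac_protocol r *
    rsum (fun a : (Defs.m rac_protocol).-tuple Zp =>
      rsum (fun b : (Defs.m rac_protocol).-tuple Zp =>
        if bB rac_protocol y (qA rac_protocol xv r a) r b == v
        then joint P rac_protocol xv y r a b else 0))) =
  sum_law n (mu Hp P) (xv y - v)%R.
Proof.
rewrite /rsum /joint /rprod /=.
pose X rho t := alice_in xv rho t; pose Y rho t := bob_in y rho t.
pose w (z : (Zp * Zp) * (Zp * Zp)) := / (INR p'.+2 ^ 2) * P z.2.1 z.2.2 z.1.1 z.1.2.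
pose G (e : {ffun 'I_n -> Zp}) : R := if (\sum_t e t == xv y - v)%R then 1 else 0.
pose F (rho : twirl) (ab : {ffun 'I_n -> Zp * Zp}) :=
  G [ffun t => box_error (rho t, ab t)] * \big[Rmult/1]_t w (rho t, ab t).
(* In [F] the argument [rho] stands for the actual box inputs rather than the masks, so the sum
   factors over the boxes and [sum_ffun_map] turns it into [sum_law]. *)
transitivity (\big[Rplus/0]_(rho : twirl) \big[Rplus/0]_ab F rho ab); last first.
  rewrite sum_ffun_pair.
  transitivity (\big[Rplus/0]_(h : {ffun 'I_n -> (Zp * Zp) * (Zp * Zp)})
     (G [ffun t => box_error (h t)] * \big[Rmult/1]_t w (h t))).
    apply: eq_bigr => h _; rewrite /F; congr (G _ * _).
      by apply/ffunP => t; rewrite !ffunE -surjective_pairing.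
    by apply: eq_bigr => t _; rewrite !ffunE -surjective_pairing.
  rewrite sum_ffun_map /sum_law [RHS]big_mkcond; apply: eq_bigr => e _.
  rewrite /G; case: ifP => _; last by rewrite Rmult_0_l.
  by rewrite Rmult_1_l; apply: eq_bigr => t _; rewrite mu_box_error.
pose shift (rho : twirl) : twirl := [ffun t => (X rho t, Y rho t)].
have shift_inj : injective shift.
  move=> r s /ffunP E; apply/ffunP => t; have := E t; rewrite !ffunE => e.
  have /GRing.addrI e1 := congr1 fst e; have /GRing.addrI e2 := congr1 snd e.
  by rewrite (surjective_pairing (r t)) (surjective_pairing (s t)) e1 e2.
(* Back from box inputs to masks, then to the indices of the randomness space. *)
rewrite [RHS](reindex_inj shift_inj) /= -[RHS]sum_enum_val.
apply: eq_bigr => r _; set rho := enum_val r.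
rewrite big_distrr /= sum_tuple_ffun.
transitivity (\big[Rplus/0]_(a : {ffun 'I_n -> Zp}) \big[Rplus/0]_(b : {ffun 'I_n -> Zp})
   F (shift rho) [ffun t => (a t, b t)]); last first.
  rewrite sum_ffun_pair; apply: eq_bigr => ab _; congr (F _ _).
  by apply/ffunP => t; rewrite !ffunE -surjective_pairing.
apply: eq_bigr => a _; rewrite big_distrr /= sum_tuple_ffun; apply: eq_bigr => b _.
under [X in (_ + X - _)%R]eq_bigr => t _ do rewrite tnth_mktuple.
under [X in (_ - X)%R]eq_bigr => t _ do rewrite tnth_mktuple.
rewrite rac_guess /F /G.
have -> : (\sum_t [ffun t => box_error (shift rho t, [ffun t0 => (a t0, b t0)] t)] t =
  \sum_t box_error ((alice_in xv rho t, bob_in y rho t), (a t, b t)))%R.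
  by apply: eq_bigr => t _; rewrite !ffunE.
set S := (\sum_t _)%R.
have -> : (xv y - S == v)%R = (S == xv y - v)%R.
  by apply/eqP/eqP => [<-|->]; ring.
case: eqP => _; last by rewrite Rmult_0_r Rmult_0_l.
rewrite Rmult_1_l -big_split /=; apply: eq_bigr => t _.
by rewrite /w !ffunE !tnth_mktuple !at_nat_ord.
Qed.

Lemma rac_dist (Hp : (0 < p'.+2)%N) (P : box p'.+2) (i : 'I_n.+1) (u v : Zp) :
  dist_xb P rac_protocol i u v = / INR p'.+2 * sum_law n (mu Hp P) (u - v)%R.
Proof.
rewrite /dist_xb {1}/rsum -big_mkcond /=.
under eq_bigr => xv /eqP xu do rewrite (rac_guess_law Hp) xu.
by rewrite -big_distrl card_ffun_at.
Qed.

End RandomAccessCode.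

(** * The error law is a probability distribution, and the final bound *)

Lemma mu_ge0 (p : nat) (Hp : (0 < p)%N) (P : box p) :
  is_box P -> forall j, 0 <= mu Hp P j.
Proof.
move=> [P0 _] j; apply: Rmult_le_pos.
  by apply/Rlt_le/Rinv_0_lt_compat/pow_lt/lt_0_INR/ltP.
by apply: rsum_ge0 => x _; apply: rsum_ge0 => y _; apply: rsum_ge0.
Qed.

Lemma mu_total (p' : nat) (Hp : (0 < p'.+2)%N) (P : box p'.+2) :
  is_box P -> \big[Rplus/0]_j mu Hp P j = 1.
Proof.
move=> [_ P1].
have p0 : INR p'.+2 <> 0 by exact: not_0_INR.
rewrite (eq_bigr _ (fun j _ => mu_box_error Hp P j)).
transitivity (\big[Rplus/0]_(z : ('I_p'.+2 * 'I_p'.+2) * ('I_p'.+2 * 'I_p'.+2))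
    (/ (INR p'.+2 ^ 2) * P z.2.1 z.2.2 z.1.1 z.1.2)).
  by rewrite (partition_big (@box_error p') xpredT).
rewrite -big_distrr /= -(pair_bigA _ (fun xy ab => P ab.1 ab.2 xy.1 xy.2)) /=.
rewrite (eq_bigr (fun=> 1)); last first.
  by move=> [x y] _; rewrite -(P1 x y) /rsum pair_bigA.
rewrite rsum_const card_prod !card_ord mult_INR /pow !Rmult_1_r Rinv_l //.
exact: Rmult_integral_contrapositive.
Qed.

Theorem theorem2 (p : nat) (Hp : prime p) (P : box p) :
  is_box P -> no_signalling P -> info_causality P ->
  forall (n : nat), (1 <= n <= p)%N -> forall c : 'I_p,
    snd (lhs (prime_gt0 Hp) P n c) = 0 /\
    fst (lhs (prime_gt0 Hp) P n c)
      <= Tp_inv p (INR n.-1 / INR n * log2 (INR p)).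
Proof.
move=> boxP _ IC n /andP [n1 _] c; have Hp1 := prime_gt1 Hp.
case: p Hp P boxP IC c Hp1 => [|[|p']] // Hp P boxP IC c _.
(* From here the code has [n.+1] dits and uses [n] boxes, so the exponent [n.-1] of the statement
   becomes [n]. *)
case: n n1 => // n _.
rewrite lhs_sum_law /=; split=> //.
set nu := mu _ P; pose W := sum_law n nu.
have W0 w : 0 <= W w by apply: sum_law_ge0; exact: mu_ge0.
have W1 : \big[Rplus/0]_w W w = 1 by apply: sum_law_total; exact: mu_total.
have p2 : 2 <= INR p'.+2 by apply: (le_INR 2); apply/leP.
have n0 : 0 < INR n.+1 by apply: lt_0_INR; apply/ltP.
have nn : 0 <= INR n by exact: pos_INR.
have lp : 0 < log2 (INR p'.+2) by apply: log2_gt0; lra.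
set z := _ * log2 _.
have zE : z * INR n.+1 = INR n * log2 (INR p'.+2).
  rewrite /z Rmult_assoc (Rmult_comm (log2 _)) -Rmult_assoc; congr Rmult.
  by rewrite /Rdiv Rmult_assoc Rinv_l; lra.
have z0 : 0 <= z.
  apply: Rmult_le_pos; last lra.
  by apply: Rmult_le_pos => //; apply/Rlt_le/Rinv_0_lt_compat.
have zp : z < log2 (INR p'.+2).
  apply: (Rmult_lt_reg_r (INR n.+1)) => //; rewrite zE (S_INR n); lra.
have [[y1 y2] yE] := Tp_inv_spec p2 z0 zp.
(* As [Tp] decreases to the right of [/ INR p], it suffices to show [z <= Tp] at [W (- c)]. *)
apply: (Tp_le_inv p2 y1).
  by rewrite -W1 (bigD1 (- c)%R) //= -{1}[sum_law _ _ _]Rplus_0_r;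
    apply: Rplus_le_compat_l; apply: rsum_ge0.
rewrite yE; apply: Rle_trans (entropy_le_Tp (- c)%R W0 W1).
(* All [n.+1] mutual informations equal [log2 p - H(W)], so information causality yields
   [n log2 p <= (n + 1) H(W)], that is [z <= H(W)]. *)
have := IC _ (rac_protocol p' n) isT (rac_valid p' n); rewrite /rsum.
rewrite (eq_bigr _ (fun i _ => mutinf_additive_noise W0 W1
  (rac_dist (prime_gt0 Hp) P i))) rsum_const card_ord.
set S := \big[_/_]_w xlog2x _ => ic.
apply: (Rmult_le_reg_r (INR n.+1)) => //; rewrite zE; move: ic; rewrite (S_INR n); lra.
Qed.
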